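(* Let $X \subseteq \mathbb{Z}^d$ be finite, non-empty and lattice-convex, let $Y \subseteq \mathbb{Z}^d \setminus X$ be finite and non-empty, let $\varepsilon > 0$ be such that $\mathrm{rc}_\varepsilon(X,Y)$ exists, and suppose that both the compact model and the cutting plane model for $(X,Y,\varepsilon)$ are feasible, where $k$ is the number of inequalities encoded in the compact model. Let $v^\star_{\mathrm{com}}$, $v^\star_{\mathrm{cut}}$ and $v^\star_{\mathrm{CG}}$ denote the optimal values of the LP relaxations of the compact, the cutting plane and the column generation model, respectively. Then: \begin{enumerate} \item If there exists an optimal solution of the LP relaxation of the column generation model that assigns at most $k$ variables a positive value, then $v^\star_{\mathrm{CG}} \geq v^\star_{\mathrm{com}} \geq v^\star_{\mathrm{cut}} = 1$. \item We have $v^\star_{\mathrm{CG}} \geq H(X,Y)$, and this inequality can be strict, i.e., there exist $X$, $Y$, $\varepsilon$ satisfying the hypotheses above with $v^\star_{\mathrm{CG}} > H(X,Y)$. \end{enumerate}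
   Context: $d$ and $k$ are positive integers and $[n]=\{1,\dots,n\}$. A set $X\subseteq\mathbb{Z}^d$ is lattice-convex if $X=\mathrm{conv}(X)\cap\mathbb{Z}^d$. Put $\rho_X=\max\{\|x\|_\infty : x\in X\}$ and $\rho_Y=\max\{\|y\|_\infty : y\in Y\}$. A hiding set for $X$ is a set $H\subseteq(\mathrm{aff}(X)\cap\mathbb{Z}^d)\setminus X$ such that $\mathrm{conv}(\{y_1,y_2\})\cap\mathrm{conv}(X)\ne\emptyset$ for all distinct $y_1,y_2\in H$. $H(X,Y)$ is the maximum cardinality of a hiding set contained in $Y$. A set $C\subseteq Y$ and $X$ are linearly $\varepsilon$-separable if there are $a\in\mathbb{R}^d$ with $\|a\|_\infty=1$ and $\beta\in\mathbb{R}$ such that $a^\top x\le\beta$ for all $x\in X$ and $a^\top y\ge\beta+\varepsilon$ for all $y\in C$. $\mathrm{rc}_\varepsilon(X,Y)$ is the smallest number of inequalities $a^\top x\le\beta$ with $\|a\|_\infty=1$, all valid for $X$, such that every $y\in Y$ satisfies $a^\top y\ge\beta+\varepsilon$ for at least one of them; it ''exists'' if such a finite family of inequalities exists. The compact and cutting plane models are considered for the same $k$, an upper bound on the number of inequalities. Compact model: with a constant $M\ge d(\rho_X+\rho_Y)+\varepsilon$, minimize $\sum_{i=1}^k u_i$ over variables $a_{ij},b_i\in\mathbb{R}$, $s_{yi},u_i$ ($y\in Y$, $i\in[k]$, $j\in[d]$) subject to $\sum_{j=1}^d a_{ij}x_j\le b_i$ for $x\in X$, $i\in[k]$; $\sum_{i=1}^k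 s_{yi}\ge1$ for $y\in Y$; $\sum_{j=1}^d a_{ij}y_j\ge b_i+\varepsilon-M(1-s_{yi})$ for $y\in Y$, $i\in[k]$; $s_{yi}\le u_i$ for $y\in Y$, $i\in[k]$; $-1\le a_{ij}\le1$ for $(i,j)\in[k]\times[d]$; $-d\rho_X\le b_i\le d\rho_X$ for $i\in[k]$; $s_{yi},u_i\in\{0,1\}$ for $y\in Y$, $i\in[k]$. Cutting plane model: let $\mathcal{C}=\{C\subseteq Y : C \text{ and } X \text{ are not linearly } \varepsilon\text{-separable}\}$. Minimize $\sum_{i=1}^k u_i$ over $s_{yi},u_i$ subject to $\sum_{i=1}^k s_{yi}\ge1$ for $y\in Y$; $\sum_{y\in C}s_{yi}\le|C|-1$ for $C\in\mathcal{C}$, $i\in[k]$; $s_{yi}\le u_i$ for $y\in Y$, $i\in[k]$; $s_{yi},u_i\in\{0,1\}$ for $y\in Y$, $i\in[k]$. Column generation model: let $\mathcal{I}=\{I\subseteq Y : I \text{ and } X \text{ are linearly } \varepsilon\text{-separable}\}$. Minimize $\sum_{I\in\mathcal{I}}z_I$ subject to $\sum_{I\in\mathcal{I}:\,y\in I}z_I\ge1$ for $y\in Y$, and $z\in\mathbb{Z}_{\geq 0}^{\mathcal{I}}$. The LP relaxation of the first two models is obtained by replacing $s_{yi},u_i\in\{0,1\}$ by $0\le s_{yi},u_i\le1$; that of the column generation model by replacing $z\in\mathbb{Z}_{\ge0}^{\mathcal{I}}$ by $z\in\mathbb{R}_{\ge0}^{\mathcal{I}}$. *)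

(* Defs.v *)
From HB Require Import structures.
From mathcomp Require Import all_boot all_order all_algebra finmap.
From mathcomp Require Import all_classical all_reals all_analysis.

Set Implicit Arguments.
Unset Strict Implicit.
Unset Printing Implicit Defensive.

Import Order.TTheory GRing.Theory Num.Theory.
Import numFieldNormedType.Exports.

Local Open Scope classical_set_scope.
Local Open Scope ring_scope.

Section Geometry.
Variables (R : realType) (d : nat).
Implicit Types (x y : 'rV[int]_d) (X : {fset 'rV[int]_d}).

Definition real_pt x : 'rV[R]_d := map_mx intr x.

Definition real_pts X : set 'rV[R]_d := real_pt @` [set` X].

Definition conv (S : set 'rV[R]_d) : set 'rV[R]_d :=
  smallest (@convex_set R 'rV[R]_d) S.

Definition affine_set (A : set 'rV[R]_d) : Prop :=
  forall (u v : 'rV[R]_d) (t : R), A u -> A v -> A (t *: u + (1 - t) *: v).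

Definition aff (S : set 'rV[R]_d) : set 'rV[R]_d := smallest affine_set S.

Definition lattice_convex X : Prop :=
  [set` X] = [set x | conv (real_pts X) (real_pt x)].

(* On 'rV[R]_d the norm `|_| is the maximum norm. *)
Definition rho X : R := \big[Num.max/0]_(x <- X) `|real_pt x|.

Definition dotp (a : 'rV[R]_d) x : R := \sum_(j < d) a 0 j * (x 0 j)%:~R.

Definition hiding_set X (H : {fset 'rV[int]_d}) : Prop :=
  (forall y, y \in H -> aff (real_pts X) (real_pt y) /\ y \notin X) /\
  (forall y1 y2, y1 \in H -> y2 \in H -> y1 != y2 ->
    conv [set real_pt y1; real_pt y2] `&` conv (real_pts X) !=set0).

Definition hiding_number X (Y : {fset 'rV[int]_d}) : nat :=
  \max_(H <- fpowerset Y | `[< hiding_set X H >]) #|` H|.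

Definition valid_ineq X (a : 'rV[R]_d) (b : R) : Prop :=
  `|a| = 1 /\ forall x, x \in X -> dotp a x <= b.

Definition separable (eps : R) (C X : {fset 'rV[int]_d}) : Prop :=
  exists (a : 'rV[R]_d) (b : R),
    valid_ineq X a b /\ forall y, y \in C -> b + eps <= dotp a y.

Definition rc_exists (eps : R) (X Y : {fset 'rV[int]_d}) : Prop :=
  exists (n : nat) (a : 'I_n -> 'rV[R]_d) (b : 'I_n -> R),
    (forall i, valid_ineq X (a i) (b i)) /\
    (forall y, y \in Y -> exists i, b i + eps <= dotp (a i) y).

End Geometry.

Section Models.
Variables (R : realType) (d k : nat).
Variables (X Y : {fset 'rV[int]_d}) (eps M : R).

(* In the models below, D is the common domain of the variables s and u:
   [set 0; 1] for the integer program, `[0, 1] for its LP relaxation.  The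
   variables s y i (and z I in the column generation model) are given by total
   functions; only their values at y in Y (at I in sep_family) matter. *)

Definition compact_constraints (D : set R) (a : 'I_k -> 'rV[R]_d)
    (b : 'I_k -> R) (s : 'rV[int]_d -> 'I_k -> R) (u : 'I_k -> R) : Prop :=
  (forall x i, x \in X -> dotp (a i) x <= b i) /\
  (forall y, y \in Y -> 1 <= \sum_(i < k) s y i) /\
  (forall y i, y \in Y -> b i + eps - M * (1 - s y i) <= dotp (a i) y) /\
  (forall y i, y \in Y -> s y i <= u i) /\
  (forall i j, -1 <= a i 0 j <= 1) /\
  (forall i, - (d%:R * rho R X) <= b i <= d%:R * rho R X) /\
  (forall y i, y \in Y -> D (s y i)) /\
  (forall i, D (u i)).

Definition cut_constraints (D : set R)
    (s : 'rV[int]_d -> 'I_k -> R) (u : 'I_k -> R) : Prop :=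
  (forall y, y \in Y -> 1 <= \sum_(i < k) s y i) /\
  (forall (C : {fset 'rV[int]_d}) i, (C `<=` Y)%fset -> ~ separable eps C X ->
     \sum_(y <- C) s y i <= #|` C|%:R - 1) /\
  (forall y i, y \in Y -> s y i <= u i) /\
  (forall y i, y \in Y -> D (s y i)) /\
  (forall i, D (u i)).

Definition compact_feasible : Prop :=
  exists a b s u, compact_constraints [set 0; 1] a b s u.

Definition cut_feasible : Prop :=
  exists s u, cut_constraints [set 0; 1] s u.

Definition sep_family : {fset {fset 'rV[int]_d}} :=
  [fset I in fpowerset Y | `[< separable eps I X >]]%fset.

Definition cg_obj (z : {fset 'rV[int]_d} -> R) : R :=
  \sum_(I <- sep_family) z I.

Definition cg_relax_feasible (z : {fset 'rV[int]_d} -> R) : Prop :=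
  (forall y, y \in Y -> 1 <= \sum_(I <- sep_family | y \in I) z I) /\
  (forall I, I \in sep_family -> 0 <= z I).

Definition cg_relax_optimal (z : {fset 'rV[int]_d} -> R) : Prop :=
  cg_relax_feasible z /\
  forall z', cg_relax_feasible z' -> cg_obj z <= cg_obj z'.

Definition v_com : \bar R :=
  ereal_inf [set v | exists a b s u,
    compact_constraints `[0, 1] a b s u /\ v = (\sum_(i < k) u i)%:E].

Definition v_cut : \bar R :=
  ereal_inf [set v | exists s u,
    cut_constraints `[0, 1] s u /\ v = (\sum_(i < k) u i)%:E].

Definition v_CG : \bar R :=
  ereal_inf [set v | exists z, cg_relax_feasible z /\ v = (cg_obj z)%:E].

Definition hypotheses : Prop :=
  X != fset0 /\ lattice_convex R X /\
  Y != fset0 /\ [disjoint X & Y]%fset /\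
  0 < eps /\ rc_exists eps X Y /\
  d%:R * (rho R X + rho R Y) + eps <= M /\
  compact_feasible /\ cut_feasible.

End Models.

(* Main.v *)
(* A feasible solution of any of the relaxations costs at least 1, because some
   y in Y has to be covered.  In the cutting plane model this is attained: every
   C in the cut family has at least two elements, so for k >= 2 the constant
   s = u = 1/k is feasible.  An optimal solution z of the column generation
   relaxation becomes a compact solution by truncating z at 1 and giving each I
   in its support its own inequality.  Finally, no linearly separable set
   contains two points of a hiding set, since a separating half-space would
   contain the segment between them, which meets conv(X); summing the covering
   constraints over a hiding set bounds its size by the value of z. *)
Require Import Defs.
From mathcomp Require Import all_boot all_order all_algebra finmap.
From mathcomp Require Import all_classical all_reals all_analysis.
From mathcomp Require Import lra.

Import Order.TTheory GRing.Theory Num.Theory.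
Import numFieldNormedType.Exports.

Local Open Scope ring_scope.

(** Serves to place a finite family of inequalities into the $k$ slots of the compact model: surplus
    slots are padded with zero and leave the sums unchanged. *)
Lemma sum_nth_widen {V : nmodType} {T : Type} (t0 : T) {r : seq T} {n} (G : T -> V) :
  (size r <= n)%N ->
  \sum_(i < n) (if (i < size r)%N then G (nth t0 r i) else 0) = \sum_(t <- r) G t.
Proof.
move=> rn; rewrite -big_mkcond /=.
by rewrite -(big_ord_widen _ (fun i => G (nth t0 r i)) rn) (big_nth t0) big_mkord.
Qed.

(** * Bounds on linear forms and on separating inequalities *)

Section Bounds.
Context {R : realType} {d : nat}.
Implicit Types (a : 'rV[R]_d) (x : 'rV[int]_d) (X C : {fset 'rV[int]_d}).

Lemma normr_coord_le a j : `|a 0 j| <= `|a|.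
Proof.
rewrite [leRHS]/Num.norm /= mx_normrE.
exact: (le_bigmax 0 (fun ij : 'I_1 * 'I_d => `|a ij.1 ij.2|) (0, j)).
Qed.

Lemma normr_const_mx1 : (0 < d)%N -> `|const_mx 1 : 'rV[R]_d| = 1.
Proof.
move=> d0; apply/eqP; rewrite eq_le; apply/andP; split.
  rewrite [leLHS]/Num.norm /= mx_normrE; apply/bigmax_leP; split=> // ij _.
  by rewrite mxE normr1.
by have := normr_coord_le (const_mx 1) (Ordinal d0); rewrite mxE normr1.
Qed.

Lemma normr_dotp_le {a} x : `|a| <= 1 -> `|dotp a x| <= d%:R * `|real_pt R x|.
Proof.
move=> a1; apply: (le_trans (ler_norm_sum _ _ _)).
rewrite -[X in X%:R * _]card_ord mulr_natl -sumr_const.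
apply: ler_sum => j _; rewrite normrM -[leRHS]mul1r.
apply: ler_pM => //; first exact: le_trans (normr_coord_le a j) a1.
by have := normr_coord_le (real_pt R x) j; rewrite mxE.
Qed.

Lemma le_rho {X x} : x \in X -> `|real_pt R x| <= rho R X.
Proof.
by move=> xX; apply: (@Order.TotalTheory.le_bigmax_seq _ _ _ X 0 x xpredT
  (fun x => `|real_pt R x|)).
Qed.

Lemma rho_ge0 X : 0 <= rho R X.
Proof. by rewrite /rho; exact: bigmax_ge_id. Qed.

Lemma normr_dotp_le_rho {X a x} : x \in X -> `|a| <= 1 ->
  `|dotp a x| <= d%:R * rho R X.
Proof.
move=> xX a1; apply: (le_trans (normr_dotp_le x a1)).
by rewrite ler_wpM2l // le_rho.
Qed.

(** The compact model confines $b_i$ to $[-d\rho_X, d\rho_X]$. Capping [b] at $d\rho_X$ keeps the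
    inequality valid, as $|a^\top x|\le d\rho_X$ on $X$, and can only help separation; the lower
    bound comes from validity at a point of the non-empty [X]. *)
Lemma separable_bounded {eps : R} {C X} : X != fset0 -> separable eps C X ->
  exists (a : 'rV[R]_d) (b : R), [/\ valid_ineq X a b,
    - (d%:R * rho R X) <= b <= d%:R * rho R X &
    forall y, y \in C -> b + eps <= dotp a y].
Proof.
move=> /fset0Pn[x0 x0X] [a [b [[a1 ab] aC]]].
have dotpX x : x \in X -> `|dotp a x| <= d%:R * rho R X.
  by move=> xX; apply: normr_dotp_le_rho => //; rewrite a1.
exists a, (Num.min b (d%:R * rho R X)); split.
- split=> // x xX; rewrite le_min ab //=.
  exact: le_trans (ler_norm _) (dotpX x xX).
- rewrite ge_min lexx orbT andbT le_min ge0_cp ?mulr_ge0 ?rho_ge0 // andbT.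
  have := dotpX x0 x0X; rewrite ler_norml => /andP[h _].
  exact: le_trans h (ab x0 x0X).
- by move=> y yC; apply: le_trans (aC y yC); rewrite lerD2r ge_min lexx.
Qed.

End Bounds.

(** * Hiding sets as lower bounds for column generation *)

Section Hiding.
Context {R : realType} {d : nat}.
Implicit Types (a p : 'rV[R]_d) (X Y H I : {fset 'rV[int]_d}).

(** A half-space is convex, so it contains the smallest convex set around [S]. *)
Lemma conv_halfspace {S : set 'rV[R]_d} {a b p} :
  (forall q, S q -> \sum_(j < d) a 0 j * q 0 j <= b) -> Defs.conv S p ->
  \sum_(j < d) a 0 j * p 0 j <= b.
Proof.
move=> Sb; apply: (@smallest_sub _ _ _
  [set q : 'rV[R]_d | \sum_(j < d) a 0 j * q 0 j <= b]%classic) => //.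
move=> u v t; rewrite !inE /= => ub vb.
have -> : \sum_(j < d) a 0 j * (conv t u v : 'rV[R]_d) 0 j =
    t%:num * (\sum_(j < d) a 0 j * u 0 j) +
    (1 - t%:num) * (\sum_(j < d) a 0 j * v 0 j).
  rewrite !mulr_sumr -big_split; apply: eq_bigr => j _ /=.
  by rewrite !mxE mulrDr !mulrA ![a 0 j * _]mulrC.
have t0 : 0 <= t%:num by [].
have t1 : t%:num <= 1 by [].
have : 0 <= 1 - t%:num by rewrite subr_ge0.
nra.
Qed.

Lemma separable_hiding_inj {eps : R} {X H I y1 y2} : 0 < eps ->
  separable eps I X -> hiding_set R X H -> y1 \in H -> y2 \in H ->
  y1 \in I -> y2 \in I -> y1 = y2.
Proof.
move=> eps0 [a [b [[_ aX] aI]]] [_ HX] y1H y2H y1I y2I; apply/eqP/negPn/negP.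
move=> /(HX _ _ y1H y2H) [p [p12 pX]].
have dotpE y : dotp a y = \sum_(j < d) a 0 j * real_pt R y 0 j.
  by apply: eq_bigr => j _; rewrite mxE.
have : \sum_(j < d) a 0 j * p 0 j <= b.
  by apply: conv_halfspace pX => _ [x xX <-]; rewrite -dotpE aX.
(* The half-space $a^\top q\ge b+\varepsilon$ holds both endpoints, hence [p]; it is written with
   normal [- a] to reuse [conv_halfspace]. *)
have : \sum_(j < d) (- a) 0 j * p 0 j <= - (b + eps).
  apply: conv_halfspace p12 => q q12.
  have [y yI ->] : exists2 y, y \in I & q = real_pt R y.
    by case: q12 => ->; [exists y1|exists y2].
  under eq_bigr do rewrite mxE mulNr.
  by rewrite sumrN -dotpE lerN2 aI.
under eq_bigr do rewrite mxE mulNr.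
rewrite sumrN lerN2; lra.
Qed.

(** Double counting: after exchanging the sums, [z I] is counted once for each point of [H] in [I],
    hence at most once. *)
Lemma hiding_set_le_cg {X Y H} {eps : R} {z} : 0 < eps -> hiding_set R X H ->
  (H `<=` Y)%fset -> cg_relax_feasible X Y eps z ->
  #|` H|%:R <= cg_obj X Y eps z.
Proof.
move=> eps0 hH /fsubsetP HY [zY z0].
have -> : (#|` H|%:R : R) = \sum_(y <- H) 1.
  by rewrite card_fset_sum1 natr_sum.
have : \sum_(y <- H) (1 : R) <=
    \sum_(y <- H) \sum_(I <- sep_family X Y eps | y \in I) z I.
  by rewrite big_seq [leRHS]big_seq; apply: ler_sum => y /HY /zY.
move=> /le_trans; apply.
rewrite (exchange_big_dep predT) //= /cg_obj big_seq [leRHS]big_seq.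
apply: ler_sum => I IF; rewrite big_fset_condE.
have sepI : separable eps I X.
  by move: IF; rewrite !inE /= => /andP[_ /asboolP].
(* The intersection of [H] and [I] is empty, where [0 <= z I] suffices, or a single point. *)
have [->|[y0 y0HI]] := fset_0Vmem [fset y in H | y \in I]%fset.
  by rewrite big_seq_fset0 z0.
have -> : [fset y in H | y \in I]%fset = [fset y0]%fset.
  apply/fsetP => y; rewrite !inE; move: y0HI; rewrite !inE /= => /andP[y0H y0I].
  apply/andP/eqP => [[yH yI]|->//].
  exact: (separable_hiding_inj eps0 sepI hH).
by rewrite big_seq_fset1.
Qed.

Lemma hiding_number_le_cg {X Y} {eps : R} {z} : 0 < eps ->
  cg_relax_feasible X Y eps z ->
  (hiding_number R X Y)%:R <= cg_obj X Y eps z.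
Proof.
move=> eps0 zf; rewrite /hiding_number big_seq_cond.
elim/big_ind: _ => [|m n hm hn|H /andP[]].
- rewrite /cg_obj big_seq; apply: sumr_ge0 => I; exact: zf.2.
- by rewrite /maxn; case: ifP.
- rewrite fpowersetE => HY /asboolP hH; exact: hiding_set_le_cg.
Qed.

End Hiding.

(** * Comparison of the three relaxations *)

Section Relaxations.
Context {R : realType} {d k : nat} {X Y : {fset 'rV[int]_d}} {eps M : R}.

Lemma cg_compact {z} : X != fset0 -> 0 < eps ->
  d%:R * (rho R X + rho R Y) + eps <= M ->
  cg_relax_feasible X Y eps z ->
  (#|` [fset I in sep_family X Y eps | (0 < z I)%R]%fset| <= k)%N ->
  exists a b s u, compact_constraints X Y eps M `[0, 1]%classic a b s u /\
    \sum_(i < k) u i <= cg_obj X Y eps z.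
Proof.
move=> X0 eps0 hM [zY z0]; set S := [fset I in _ | _]%fset => Sk.
have dX : 0 <= d%:R * rho R X by rewrite mulr_ge0 ?rho_ge0.
have dY : 0 <= d%:R * rho R Y by rewrite mulr_ge0 ?rho_ge0.
rewrite mulrDr in hM.
(* The requirement is void outside [S], so a total choice function exists; the default pair there is
   [(0, 0)]. *)
pose good I (c : 'rV[R]_d * R) := I \in S ->
  [/\ valid_ineq X c.1 c.2, - (d%:R * rho R X) <= c.2 <= d%:R * rho R X &
      forall y, y \in I -> c.2 + eps <= dotp c.1 y].
have /choice[c cP] : forall I, exists c, good I c.
  move=> I; have [IS|nIS] := boolP (I \in S); last first.
    by exists (0, 0); rewrite /good (negbTE nIS).
  have sepI : separable eps I X.
    by move: IS; rewrite !inE /= => /andP[/andP[_ /asboolP]].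
  have [a [b abP]] := separable_bounded X0 sepI.
  by exists (a, b).
pose J i := nth fset0 S i.
have JS i : (i < size S)%N -> J i \in S by move=> ?; exact: mem_nth.
pose w I := Num.min (z I) 1.
have SF I : I \in S -> I \in sep_family X Y eps /\ 0 < z I.
  by rewrite in_fset !inE /= => /andP[].
have w01 I : I \in S -> 0 <= w I <= 1.
  move=> /SF[IF zI]; rewrite /w le_min ge_min lexx orbT andbT ler01 andbT.
  exact: ltW.
(* Slot [i] carries the inequality of the [i]-th member of [S], with weight [w] capped at 1 to
   respect the domain of [s] and [u]; surplus slots carry $0\le 0$ with weight 0. *)
exists (fun i => if (i < size S)%N then (c (J i)).1 else 0),
  (fun i => if (i < size S)%N then (c (J i)).2 else 0),
  (fun y i => if (i < size S)%N then (if y \in J i then w (J i) else 0) else 0),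
  (fun i => if (i < size S)%N then w (J i) else 0).
have dotp0 y : dotp (0 : 'rV[R]_d) y = 0.
  by rewrite /dotp big1 // => j _; rewrite mxE mul0r.
split; last first.
  rewrite (sum_nth_widen fset0 w Sk) /cg_obj /S -big_fset_condE.
  rewrite big_mkcond /= big_seq [leRHS]big_seq; apply: ler_sum => I IF.
  by case: ifP => _; [rewrite ge_min lexx|exact: z0].
split; [|split; [|split; [|split; [|split; [|split; [|split]]]]]].
- move=> x i xX; case: ifP => [/JS /cP[[_ ->]]//|_]; by rewrite dotp0.
- move=> y yY.
  rewrite (sum_nth_widen fset0 (fun I => if y \in I then w I else 0) Sk).
  have wS0 I : I \in S -> 0 <= (if y \in I then w I else 0).
    by move=> /w01 /andP[? _]; case: ifP.
  (* If some [I] in [S] containing [y] has [1 <= z I], its capped weight 1 alone covers [y].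
     Otherwise the cap changes no weight relevant to [y], and the covering constraint for [z]
     carries over. *)
  have [[I [IS yI zI1]]|zlt1] :=
      pselect (exists I, [/\ I \in S, y \in I & 1 <= z I]).
    rewrite (big_fsetD1 I) //= yI /w min_r // lerDl big_seq.
    by apply: sumr_ge0 => I'; rewrite in_fsetD1 => /andP[_ /wS0].
  apply: le_trans (zY y yY) _.
  rewrite /S -big_fset_condE big_mkcond [leRHS]big_mkcond.
  rewrite big_seq [leRHS]big_seq; apply: ler_sum => I IF /=.
  have [yI|_] := ifP; last by case: ifP.
  have [zI0|] := ltP 0 (z I); last by [].
  rewrite /w le_min lexx /= leNgt.
  have IS : I \in S by rewrite in_fset !inE /= zI0 andbT; move: IF; rewrite !inE.
  by apply/negP => /ltW zI1; apply: zlt1; exists I.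
(* For [y] outside [J i], and in surplus slots, the full slack [M] is available and $M\ge
   d(\rho_X+\rho_Y)+\varepsilon$ suffices. For [y] in [J i] separation already gives the bound, and
   the term with [M] only weakens it. *)
- move=> y i yY; case: ifP => [/JS iS|_]; last by rewrite dotp0; lra.
  have [[a1 _] /andP[b1 b2] aI] := cP _ iS.
  have a1' : `|(c (J i)).1| <= 1 by rewrite a1.
  have := normr_dotp_le_rho yY a1'; rewrite ler_norml => /andP[h1 h2].
  case: ifP => [yI|_]; last by lra.
  have := aI y yI; have := w01 _ iS; move=> /andP[w0 w1].
  have : 0 <= M * (1 - w (J i)) by apply: mulr_ge0; lra.
  lra.
- move=> y i yY; case: ifP => // /JS /w01 /andP[w0 _]; by case: ifP.
- move=> i j; case: ifP => [/JS /cP[[a1 _] _ _]|_]; last by rewrite mxE; lra.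
  by rewrite -ler_norml -a1 normr_coord_le.
- by move=> i; case: ifP => [/JS /cP[_ ? _]//|_]; rewrite oppr_le0 dX.
- move=> y i yY /=; rewrite in_itv /=; case: ifP => [/JS /w01 ?|_]; last lra.
  by case: ifP => // _; lra.
- by move=> i /=; rewrite in_itv /=; case: ifP => [/JS /w01 ?//|_]; lra.
Qed.

(** Stated for bare [s] and [u], so that it serves both the compact and the cutting plane
    relaxation. *)
Lemma cover_le_obj {s : 'rV[int]_d -> 'I_k -> R} {u : 'I_k -> R} :
  Y != fset0 -> (forall y, y \in Y -> 1 <= \sum_(i < k) s y i) ->
  (forall y i, y \in Y -> s y i <= u i) -> 1 <= \sum_(i < k) u i.
Proof.
move=> /fset0Pn[y yY] s1 su; apply: le_trans (s1 y yY) _.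
by apply: ler_sum => i _; exact: su.
Qed.

(** A singleton in [Y] is separated by the member of the family responsible for its point, and the
    empty set by any member; a member exists because [Y] is non-empty. *)
Lemma rc_card_not_separable {C : {fset 'rV[int]_d}} : Y != fset0 ->
  rc_exists eps X Y -> (C `<=` Y)%fset -> ~ separable eps C X ->
  (1 < #|` C|)%N.
Proof.
move=> /fset0Pn[y0 y0Y] [n [a [b [aX aY]]]] /fsubsetP CY nsep.
rewrite ltnNge leq_eqVlt ltnS leqn0 cardfs_eq0.
apply/negP => /orP[/cardfs1P[y yC]|/eqP C0]; apply: nsep.
  have yY : y \in Y by rewrite CY // yC in_fset1.
  have [i yi] := aY y yY; exists (a i), (b i); split; first exact: aX.
  by move=> y'; rewrite yC in_fset1 => /eqP ->.
have [i _] := aY y0 y0Y; exists (a i), (b i); split; first exact: aX.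
by move=> y; rewrite C0 in_fset0.
Qed.

Lemma cut_relax_attains1 : (0 < k)%N -> Y != fset0 -> rc_exists eps X Y ->
  cut_feasible k X Y eps ->
  exists (s : 'rV[int]_d -> 'I_k -> R) (u : 'I_k -> R),
    cut_constraints X Y eps `[0, 1]%classic s u /\ \sum_(i < k) u i <= 1.
Proof.
move=> k0 Y0 rcXY [s [u [s1 [sC [su [s01 u01]]]]]].
(* For k = 1 the value 1/k violates the cuts, but the integer solution costs 1. *)
have [k1|k1] := leqP k 1.
  exists s, u; split.
    split=> //; split=> //; split=> //.
    split=> [y i yY|i] /=; rewrite in_itv /=.
      by have [->|->] := s01 y i yY; lra.
    by have [->|->] := u01 i; lra.
  apply: (@le_trans _ _ (\sum_(i < k) 1)).
    by apply: ler_sum => i _; have [->|->] := u01 i.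
  by rewrite sumr_const card_ord lern1.
have kR : (2 : R) <= k%:R by rewrite ler_nat.
have kV0 : 0 <= (k%:R : R)^-1 by rewrite invr_ge0 ler0n.
have kV1 : (k%:R : R)^-1 <= 2^-1 by rewrite lef_pV2 // posrE //; lra.
have sumk : \sum_(i < k) (k%:R : R)^-1 = 1.
  by rewrite sumr_const card_ord -[LHS]mulr_natl divff // pnatr_eq0 -lt0n.
exists (fun _ _ => k%:R^-1), (fun _ => k%:R^-1); rewrite sumk; split=> //.
split=> [y yY|]; first by rewrite sumk.
split=> [C i CY nsep|].
  (* With $k\ge2$ and $|C|\ge2$, the cut holds because $|C|/k\le|C|/2\le|C|-1$. *)
  have /(_ CY nsep) := @rc_card_not_separable C Y0 rcXY.
  rewrite big_const_seq count_predT iter_addr_0 -mulr_natl => C2.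
  have : (2 : R) <= #|` C|%:R by rewrite ler_nat.
  nra.
split=> //; split=> [y i yY|i] /=; rewrite in_itv /= kV0 /=; lra.
Qed.

Lemma v_cut_eq1 : (0 < k)%N -> Y != fset0 -> rc_exists eps X Y ->
  cut_feasible k X Y eps -> v_cut k X Y eps = 1%:E.
Proof.
move=> k0 Y0 rcXY cutf; apply/eqP; rewrite eq_le; apply/andP; split.
  have [s [u [su u1]]] := cut_relax_attains1 k0 Y0 rcXY cutf.
  apply: ge_ereal_inf; exists (\sum_(i < k) u i)%:E; last by rewrite lee_fin.
  by exists s, u.
apply/ereal_infP => _ [s [u [[s1 [_ [su _]]] ->]]].
by rewrite lee_fin; exact: cover_le_obj su.
Qed.

Lemma v_com_ge1 : Y != fset0 -> (1 <= v_com k X Y eps M)%E.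
Proof.
move=> Y0; apply/ereal_infP => _ [a [b [s [u [[_ [s1 [_ [su _]]]] ->]]]]].
by rewrite lee_fin; exact: cover_le_obj su.
Qed.

Lemma v_com_le_v_CG {z} : X != fset0 -> 0 < eps ->
  d%:R * (rho R X + rho R Y) + eps <= M ->
  cg_relax_optimal X Y eps z ->
  (#|` [fset I in sep_family X Y eps | (0 < z I)%R]%fset| <= k)%N ->
  (v_com k X Y eps M <= v_CG X Y eps)%E.
Proof.
move=> X0 eps0 hM [zf zopt] zk.
have [a [b [s [u [cc uz]]]]] := cg_compact X0 eps0 hM zf zk.
apply/ereal_infP => _ [z' [z'f ->]].
apply: ge_ereal_inf; exists (\sum_(i < k) u i)%:E; first by exists a, b, s, u.
by rewrite lee_fin; apply: le_trans uz (zopt z' z'f).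
Qed.

End Relaxations.

(** * A one-point example with a strict gap *)

Section StrictExample.
Context {R : realType} {d : nat} (k : nat) (d0 : (0 < d)%N) (k0 : (0 < k)%N).

(** The inequality with normal $(1,\dots,1)$ and right-hand side 0 separates the two points with
    margin $d\ge1$, so $\varepsilon=1$ is admissible for every $d$ and $k$; [M] is the least
    constant allowed for it. *)
Let X : {fset 'rV[int]_d} := [fset 0]%fset.
Let Y : {fset 'rV[int]_d} := [fset const_mx 1]%fset.
Let M : R := d%:R * (rho R X + rho R Y) + 1.
Let a : 'rV[R]_d := const_mx 1.

Let real_ptsX : real_pts X = [set 0 : 'rV[R]_d]%classic.
Proof.
have r0 : real_pt R (0 : 'rV[int]_d) = 0 by apply/rowP => j; rewrite !mxE.
apply/seteqP; split => [_ [x /= + <-]|_ ->].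
  by rewrite in_fset1 => /eqP ->.
by exists 0 => //=; rewrite in_fset1.
Qed.

Let real_pt_eq0 (x : 'rV[int]_d) : real_pt R x = 0 -> x = 0.
Proof.
move=> /rowP x0; apply/rowP => j; have := x0 j; rewrite !mxE.
by move=> /eqP; rewrite intr_eq0 => /eqP.
Qed.

Let const_mx1_neq0 : (const_mx 1 : 'rV[int]_d) != 0.
Proof.
by apply/eqP => /rowP /(_ (Ordinal d0)); rewrite !mxE.
Qed.

Let valid_a : valid_ineq X a 0.
Proof.
split=> [|x]; first exact: normr_const_mx1.
rewrite in_fset1 => /eqP ->; rewrite /dotp big1 // => j _.
by rewrite !mxE mulr0.
Qed.

Let a_sep y : y \in Y -> (0 : R) + 1 <= dotp a y.
Proof.
rewrite in_fset1 => /eqP ->; rewrite /dotp.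
under eq_bigr do rewrite !mxE mulr1.
by rewrite sumr_const card_ord add0r ler1n.
Qed.

Let lattice_convexX : lattice_convex R X.
Proof.
rewrite /lattice_convex real_ptsX; apply/seteqP; split => [x /=|x /= cx].
  rewrite in_fset1 => /eqP ->; apply: sub_gen_smallest => /=.
  by apply/rowP => j; rewrite !mxE.
rewrite in_fset1; apply/eqP/real_pt_eq0.
apply: (@smallest_sub _ _ [set 0]%classic [set 0]%classic) cx => //.
by move=> u v t; rewrite !inE => -> ->; apply/eqP; rewrite convmm.
Qed.

Lemma strict_example_hypotheses : hypotheses k X Y 1 M.
Proof.
have dX : 0 <= d%:R * rho R X by rewrite mulr_ge0 ?rho_ge0.
have s1 : 1 <= \sum_(i < k) (1 : R) by rewrite sumr_const card_ord ler1n.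
split; first by apply/fset0Pn; exists 0; rewrite in_fset1.
split; first exact: lattice_convexX.
split; first by apply/fset0Pn; exists (const_mx 1); rewrite in_fset1.
split; first by rewrite fdisjointX1 in_fset1 const_mx1_neq0.
split; first exact: ltr01.
split.
  exists 1%N, (fun=> a), (fun=> 0); split=> // y yY.
  by exists ord0; exact: a_sep.
split; first exact: lexx.
split.
  (* All slots repeat the same inequality with [s = u = 1], so the term with [M] vanishes. *)
  exists (fun=> a), (fun=> 0), (fun _ _ => 1), (fun=> 1).
  split; first by move=> x i; exact: valid_a.2.
  split=> //; split; first by move=> y i yY; rewrite subrr mulr0 subr0 a_sep.
  split=> //; split; first by move=> i j; rewrite mxE; lra.
  split; first by move=> i; rewrite oppr_le0 dX.
  by split=> *; right.
exists (fun _ _ => 1), (fun=> 1).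
split=> //; split.
  (* Every subset of [Y] is separable, so the cut family is empty. *)
  move=> C i /fsubsetP CY []; exists a, 0; split; first exact: valid_a.
  by move=> y /CY; exact: a_sep.
by do 2 split=> //; move=> *; right.
Qed.

(* Hiding sets have to lie in aff(X) = {0}, hence those in Y are empty. *)
Lemma strict_example_gap : ((hiding_number R X Y)%:R%:E < v_CG X Y (1 : R))%E.
Proof.
have -> : hiding_number R X Y = 0%N.
  apply/eqP; rewrite -leqn0; apply/bigmax_leqP_seq => H.
  rewrite fpowersetE => /fsubsetP HY /asboolP[Haff _].
  rewrite leqn0 cardfs_eq0; apply/eqP/fsetP => y; rewrite in_fset0.
  apply/negbTE/negP => yH; have [+ /negP] := Haff y yH; rewrite real_ptsX in_fset1.
  move=> yaff; apply; apply/eqP/real_pt_eq0.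
  apply: (@smallest_sub _ _ [set 0]%classic [set 0]%classic) yaff => //.
  by move=> u v t /= -> ->; rewrite !scaler0 addr0.
(* Covering the single point of [Y] already costs at least 1. *)
apply: (@lt_le_trans _ _ 1%:E); first by rewrite lte_fin ltr01.
apply/ereal_infP => _ [z [[zY z0] ->]]; rewrite lee_fin.
have yY : const_mx 1 \in Y by rewrite in_fset1.
apply: le_trans (zY _ yY) _; rewrite /cg_obj big_mkcond big_seq [leRHS]big_seq.
by apply: ler_sum => I IF; case: ifP => // _; exact: z0.
Qed.

End StrictExample.

Theorem proposition3p2 (R : realType) (d k : nat) (hd : (0 < d)%N)
    (hk : (0 < k)%N) :
  (forall (X Y : {fset 'rV[int]_d}) (eps M : R), hypotheses k X Y eps M ->
     ((exists z : {fset 'rV[int]_d} -> R,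
         cg_relax_optimal X Y eps z /\
         (#|` [fset I in sep_family X Y eps | (0 < z I)%R]%fset| <= k)%N) ->
      (v_com k X Y eps M <= v_CG X Y eps)%E /\
      (v_cut k X Y eps <= v_com k X Y eps M)%E /\
      v_cut k X Y eps = 1%:E) /\
     ((hiding_number R X Y)%:R%:E <= v_CG X Y eps)%E) /\
  (exists (X Y : {fset 'rV[int]_d}) (eps M : R), hypotheses k X Y eps M /\
     ((hiding_number R X Y)%:R%:E < v_CG X Y eps)%E).
Proof.
split; last first.
  by do 4 eexists; split; [exact: strict_example_hypotheses|
                           exact: strict_example_gap].
move=> X Y eps M [X0 [_ [Y0 [_ [eps0 [rcXY [hM [_ cutf]]]]]]]].
split; last first.
  apply/ereal_infP => _ [z [zf ->]].
  by rewrite lee_fin; exact: hiding_number_le_cg.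
have cut1 := v_cut_eq1 hk Y0 rcXY cutf.
move=> [z [zopt zk]]; split; first exact: v_com_le_v_CG zopt zk.
by rewrite cut1; split=> //; exact: v_com_ge1.
Qed.
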